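(* Let $E,A\in\mathbb{R}^{n\times n}$ and $C\in\mathbb{R}^{m\times n}$, with $E$ singular and the pencil $sE-A$ regular. Then the following statements are equivalent: 1) the system $E\dot x(t)=Ax(t),\ y(t)=Cx(t)$ is impulse observable; 2) $\operatorname{rank}(\mathcal{O}_{r+2}(E,A,C))=n(r+1)+\operatorname{rank}(E)$ for some $r\in\{0,1,\ldots,n-1\}$; 3) $\operatorname{rank}(\mathcal{O}_{r+2}(E,A,C))=n(r+1)+\operatorname{rank}(E)$ for every $r\in\{0,1,\ldots,n-1\}$.
   Context: The pencil $sE-A$ is regular if $\det(sE-A)$ is not the zero polynomial in $s$. $\mathbb{R}^n(s)$ denotes the set of $n$-dimensional vectors of rational functions in $s$ (with real coefficients). Every $F(s)\in\mathbb{R}^n(s)$ is uniquely a sum $F=F_{\mathrm A}+F_{\mathrm P}$ of a vector $F_{\mathrm A}$ of strictly proper rational functions and a polynomial vector $F_{\mathrm P}$ (the polynomial part). Definition (impulse observability): the system $E\dot x=Ax,\ y=Cx$ is impulse observable if the equation $$\begin{bmatrix} sE-A\\ C\end{bmatrix}X(s)=\begin{bmatrix}Ew\\0\end{bmatrix}$$ in the unknowns $(w,X(s))\in\mathbb{R}^n\times\mathbb{R}^n(s)$ has no solution with $X_{\mathrm P}(s)$ nonzero. For an integer $k\ge 2$, $\mathcal{O}_k(E,A,C)$ is the real $(kn+(k-1)m)\times kn$ matrix partitioned into $k$ block columns (each of width $n$) and $2k-1$ block rows as follows. The first $k$ block rows (each of height $n$) form the block upper bidiagonal matrix with $E$ in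 each diagonal block $(i,i)$, $1\le i\le k$, and $A$ in each superdiagonal block $(i,i+1)$, $1\le i\le k-1$. The remaining $k-1$ block rows (each of height $m$) have, in the $j$-th of them ($1\le j\le k-1$), the block $C$ in block column $j+1$. All other blocks are zero. *)

(* Defs.v *)
From HB Require Import structures.
From mathcomp Require Import all_boot all_order all_algebra.
From mathcomp Require Import reals.

Set Implicit Arguments.
Unset Strict Implicit.
Unset Printing Implicit Defensive.

Import Order.TTheory GRing.Theory Num.Theory.
Local Open Scope ring_scope.

Local Notation tofrac := (@FracField.tofrac _).

Definition pencil (R : realType) (n : nat) (E A : 'M[R]_n) : 'M[{poly R}]_n :=
  'X *: map_mx polyC E - map_mx polyC A.

Definition regular_pencil (R : realType) (n : nat) (E A : 'M[R]_n) : Prop :=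
  \det (pencil E A) != 0.

Definition poly_to_rat (R : realType) (m n : nat) (P : 'M[{poly R}]_(m, n)) :
  'M[{fraction {poly R}}]_(m, n) := map_mx tofrac P.

Definition const_to_rat (R : realType) (m n : nat) (M : 'M[R]_(m, n)) :
  'M[{fraction {poly R}}]_(m, n) := poly_to_rat (map_mx polyC M).

(* [size p < size q] is deg p < deg q, with deg 0 = -oo. *)
Definition strictly_proper (R : realType) (f : {fraction {poly R}}) : Prop :=
  exists p q : {poly R},
    [/\ q != 0, (size p < size q)%N & f = tofrac p / tofrac q].

Definition is_poly_part (R : realType) (n : nat)
    (F : 'cV[{fraction {poly R}}]_n) (FP : 'cV[{poly R}]_n) : Prop :=
  exists FA : 'cV[{fraction {poly R}}]_n,
    (forall i, strictly_proper (FA i ord0)) /\ F = FA + poly_to_rat FP.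

Lemma strictly_proper_poly0 (R : realType) (p : {poly R}) :
  strictly_proper (tofrac p) -> p = 0.
Proof.
case=> a [q [q0 sz e]]; apply/eqP; case: (eqVneq p 0) => // p0.
have /eqP : tofrac (p * q) = tofrac a.
  by rewrite rmorphM /= e divfK // tofrac_eq0.
rewrite tofrac_eq => /eqP ea; move: sz; rewrite -ea size_mul // => sz.
move: p0 sz; rewrite -size_poly_gt0; case: (size p) => // k _.
by rewrite addSn /= ltnNge leq_addl.
Qed.

Lemma strictly_properB (R : realType) (f g : {fraction {poly R}}) :
  strictly_proper f -> strictly_proper g -> strictly_proper (f - g).
Proof.
case=> a [b [b0 sab ->]] [c [d [d0 scd ->]]].
exists (a * d - c * b), (b * d); split; first by rewrite mulf_neq0.
  have lt (x u v : {poly R}) : u != 0 -> v != 0 -> (size x < size u)%N ->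
      (size (x * v)%R < size (u * v)%R)%N.
    move=> u0 v0 s; case: (eqVneq x 0) => [->|x0].
      by rewrite mul0r size_poly0 size_poly_gt0 mulf_neq0.
    rewrite !size_mul //; move: v0 x0; rewrite -!size_poly_gt0.
    case: (size v) => // kv _; case: (size x) s => // kx s _.
    by rewrite !addnS /= ltn_add2r.
  apply: leq_ltn_trans (size_polyD _ _) _; rewrite size_polyN gtn_max.
  by rewrite lt // [b * d]mulrC lt.
by rewrite -mulNr addf_div ?tofrac_eq0 // rmorphB !rmorphM /= mulNr.
Qed.

Lemma frac_numden (D : idomainType) (f : {fraction D}) :
  f = tofrac \n_(repr f) / tofrac \d_(repr f).
Proof.
have d0 : \d_(repr f) != 0 by exact: denom_ratioP.
apply: (mulIf (x := tofrac \d_(repr f))); first by rewrite tofrac_eq0.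
rewrite divfK ?tofrac_eq0 // -[f in LHS]reprK; unlock FracField.tofrac.
rewrite -[LHS]FracField.pi_mul; apply/eqmodP => /=.
rewrite FracField.equivfE /FracField.mulf /=.
by rewrite !numden_Ratio ?mulf_neq0 ?oner_eq0 // reprK !mulr1 mulrC.
Qed.

Lemma poly_part_exists (R : realType) (n : nat)
    (F : 'cV[{fraction {poly R}}]_n) :
  exists FP, is_poly_part F FP.
Proof.
pose N i := \n_(repr (F i ord0)); pose D i := \d_(repr (F i ord0)).
have D0 i : D i != 0 by exact: denom_ratioP.
exists (\col_i (N i %/ D i)), (\col_i (tofrac (N i %% D i) / tofrac (D i))).
split=> [i|]; first by rewrite mxE; exists (N i %% D i), (D i); rewrite ltn_modp.
apply/colP => i; rewrite !mxE [LHS]frac_numden -/(N i) -/(D i).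
rewrite {1}(divp_eq (N i) (D i)) rmorphD rmorphM /= mulrDl mulfK ?tofrac_eq0 //.
exact: addrC.
Qed.

Lemma poly_part_unique (R : realType) (n : nat)
    (F : 'cV[{fraction {poly R}}]_n) (P Q : 'cV[{poly R}]_n) :
  is_poly_part F P -> is_poly_part F Q -> P = Q.
Proof.
case=> a [sa ->] [b [sb e]]; apply/colP => i.
apply/eqP; rewrite -subr_eq0; apply/eqP/strictly_proper_poly0.
have -> : tofrac (P i ord0 - Q i ord0) = b i ord0 - a i ord0.
  move/colP/(_ i): e; rewrite !mxE rmorphB /= => e.
  by apply/eqP; rewrite subr_eq addrAC eq_sym subr_eq -e addrC.
exact: strictly_properB.
Qed.

Definition impulse_observable (R : realType) (m n : nat)
    (E A : 'M[R]_n) (C : 'M[R]_(m, n)) : Prop :=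
  ~ exists (w : 'cV[R]_n) (X : 'cV[{fraction {poly R}}]_n)
      (XP : 'cV[{poly R}]_n),
    [/\ col_mx (poly_to_rat (pencil E A)) (const_to_rat C) *m X
          = col_mx (const_to_rat (E *m w)) 0,
        is_poly_part X XP & XP != 0].

(* Zero-based indices: row i of the lower part has C in block column i + 1. *)
Definition obs_mx (R : realType) (m n k : nat)
    (E A : 'M[R]_n) (C : 'M[R]_(m, n)) :
    'M[R]_(\sum_(i < k) n + \sum_(i < k.-1) m, \sum_(j < k) n) :=
  col_mx
    (\mxblock_(i < k, j < k)
       (if j == i then E else if j == i.+1 :> nat then A else 0))
    (\mxblock_(i < k.-1, j < k) (if j == i.+1 :> nat then C else 0)).

(* Main.v *)
(* Every condition says that no nonzero v satisfies E v = 0, C v = 0 and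
   A v \in im E. If A v = E w, then X = v solves the equation with right-hand
   side E (- w), and (- w, v, 0, ..., 0) is in the kernel of O_k. Conversely, the
   last nonzero coefficient of X_P, respectively the last nonzero block (other
   than the first) of a kernel vector of O_k, is such a v. The kernel of O_k
   always contains (u, 0, ..., 0) for u in ker E, and the rank condition says
   that it contains nothing else. *)
Require Import Defs.
From mathcomp Require Import all_boot all_order all_algebra.
From mathcomp Require Import reals zify.

Set Implicit Arguments.
Unset Strict Implicit.
Unset Printing Implicit Defensive.

Import Order.TTheory GRing.Theory Num.Theory.
Local Open Scope ring_scope.

Local Notation tofrac := (@FracField.tofrac _).

Definition no_impulsive_direction (F : fieldType) (m n : nat)
    (E A : 'M[F]_n) (C : 'M[F]_(m, n)) : Prop :=
  forall v : 'cV[F]_n,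
    E *m v = 0 -> C *m v = 0 -> (exists w, A *m v = E *m w) -> v = 0.

(** * Polynomial parts of rational vectors *)

Lemma strictly_proper0 (R : realType) : strictly_proper (0 : {fraction {poly R}}).
Proof.
exists 0, 1; split; rewrite ?oner_eq0 //; first by rewrite size_poly0 size_poly1.
by rewrite rmorph0 mul0r.
Qed.

Lemma strictly_properD (R : realType) (f g : {fraction {poly R}}) :
  strictly_proper f -> strictly_proper g -> strictly_proper (f + g).
Proof.
move=> fp gp; rewrite -[g]opprK; apply: strictly_properB => //.
by rewrite -sub0r; apply: strictly_properB => //; apply: strictly_proper0.
Qed.

Lemma strictly_properZ (R : realType) (c : R) (f : {fraction {poly R}}) :
  strictly_proper f -> strictly_proper (tofrac c%:P * f).
Proof.
case=> p [q [q0 sz ->]]; exists (c *: p), q; split=> //.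
  exact: leq_ltn_trans (size_scale_leq _ _) sz.
by rewrite mulrA -rmorphM mul_polyC.
Qed.

Lemma strictly_properVX (R : realType) (f : {fraction {poly R}}) :
  strictly_proper f -> strictly_proper ((tofrac 'X)^-1 * f).
Proof.
case=> p [q [q0 sz ->]]; exists p, ('X * q); split.
- by rewrite mulf_neq0 ?polyX_eq0.
- by rewrite size_mul ?polyX_eq0 // size_polyX; apply: ltnW.
- by rewrite rmorphM /= invfM mulrCA.
Qed.

Lemma is_poly_part_poly (R : realType) (n : nat) (P : 'cV[{poly R}]_n) :
  is_poly_part (poly_to_rat P) P.
Proof.
exists 0; split=> [i|]; last by rewrite add0r.
by rewrite mxE; apply: strictly_proper0.
Qed.

Lemma is_poly_partD (R : realType) (n : nat)
    (F G : 'cV[{fraction {poly R}}]_n) (P Q : 'cV[{poly R}]_n) :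
  is_poly_part F P -> is_poly_part G Q -> is_poly_part (F + G) (P + Q).
Proof.
case=> a [sa ->] [b [sb ->]]; exists (a + b); split=> [i|].
  by rewrite mxE; apply: strictly_properD.
by rewrite /poly_to_rat map_mxD addrACA.
Qed.

Lemma is_poly_part_mulmx (R : realType) (m n : nat) (M : 'M[R]_(m, n))
    (F : 'cV[{fraction {poly R}}]_n) (P : 'cV[{poly R}]_n) :
  is_poly_part F P ->
  is_poly_part (const_to_rat M *m F) (map_mx polyC M *m P).
Proof.
case=> a [sa ->]; exists (const_to_rat M *m a); split=> [i|].
  rewrite mxE; apply: big_ind => [||j _].
  - exact: strictly_proper0.
  - by move=> ? ?; apply: strictly_properD.
  - by rewrite 2!mxE; apply/strictly_properZ/sa.
by rewrite mulmxDr /poly_to_rat map_mxM.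
Qed.

(** The constant coefficient divided by s is strictly proper and leaves the polynomial part; the
    other coefficients move down one degree. *)
Lemma is_poly_partVX (R : realType) (n : nat)
    (F : 'cV[{fraction {poly R}}]_n) (P : 'cV[{poly R}]_n) :
  is_poly_part F P ->
  is_poly_part ((tofrac 'X)^-1 *: F) (map_mx (drop_poly 1) P).
Proof.
case=> a [sa ->].
exists ((tofrac 'X)^-1 *: (a + poly_to_rat (map_mx (take_poly 1) P))).
have X0 : tofrac 'X != 0 :> {fraction {poly R}} by rewrite tofrac_eq0 polyX_eq0.
split=> [i|].
  rewrite !mxE mulrDr; apply: strictly_properD; first exact: strictly_properVX.
  exists (take_poly 1 (P i ord0)), 'X; split; rewrite ?polyX_eq0 1?mulrC //.
  by rewrite size_polyX ltnS size_take_poly.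
apply/colP => i; rewrite !mxE -{1}[P i ord0](poly_take_drop 1).
by rewrite rmorphD rmorphM /= addrA [LHS]mulrDr [_ * tofrac 'X]mulrC mulKf.
Qed.

(** * Coefficients of the polynomial part and impulse observability *)

Lemma map_coefp_mulmx (R : realType) (i m n p : nat) (M : 'M[R]_(m, n))
    (P : 'M[{poly R}]_(n, p)) :
  map_mx (coefp i) (map_mx polyC M *m P) = M *m map_mx (coefp i) P.
Proof.
apply/matrixP => j k; rewrite !mxE raddf_sum; apply: eq_bigr => l _ /=.
by rewrite !mxE coefCM.
Qed.

(** By uniqueness, the polynomial part M P of M F vanishes together with M F. *)
Lemma poly_part_kernel (R : realType) (m n : nat) (M : 'M[R]_(m, n))
    (F : 'cV[{fraction {poly R}}]_n) (P : 'cV[{poly R}]_n) :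
  is_poly_part F P -> const_to_rat M *m F = 0 ->
  forall i, M *m map_mx (coefp i) P = 0.
Proof.
move=> FP MF i; rewrite -map_coefp_mulmx.
have -> : map_mx polyC M *m P = 0.
  apply: (@poly_part_unique _ _ 0); first by rewrite -MF; apply: is_poly_part_mulmx.
  have -> : 0 = poly_to_rat (0 : 'cV[{poly R}]_m).
    by apply/matrixP => j k; rewrite !mxE rmorph0.
  exact: is_poly_part_poly.
by apply/matrixP => j k; rewrite !mxE raddf0.
Qed.

Lemma impulse_observableP (R : realType) (m n : nat)
    (E A : 'M[R]_n) (C : 'M[R]_(m, n)) :
  impulse_observable E A C <-> no_impulsive_direction E A C.
Proof.
have constM p q r (M : 'M[R]_(p, q)) (N : 'M[R]_(q, r)) :
    const_to_rat (M *m N) = const_to_rat M *m const_to_rat N.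
  by rewrite /const_to_rat /poly_to_rat !map_mxM.
have const0 p q : const_to_rat (0 : 'M[R]_(p, q)) = 0.
  by apply/matrixP => j k; rewrite !mxE !rmorph0.
have pencilE : poly_to_rat (pencil E A)
    = tofrac 'X *: const_to_rat E - const_to_rat A.
  by apply/matrixP => j k; rewrite !mxE rmorphB rmorphM.
split=> [IO v Ev Cv [w Aw]|ND [w [X [XP []]]]].
  apply/eqP/negP => /negP v0; apply: IO.
  exists (- w), (const_to_rat v), (map_mx polyC v); split.
  - rewrite mul_col_mx -constM Cv const0 pencilE mulmxBl -scalemxAl -!constM.
    rewrite Ev const0 scaler0 sub0r Aw mulmxN; congr col_mx.
    by apply/matrixP => j k; rewrite !mxE !rmorphN.
  - exact: is_poly_part_poly.
  - apply: contra_neq v0 => /matrixP v0; apply/matrixP => j k.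
    by move: (v0 j k); rewrite !mxE => /polyC_inj.
rewrite mul_col_mx pencilE mulmxBl -scalemxAl => /eq_col_mx [eqE CX] XXP /eqP[].
have X0 : tofrac 'X != 0 :> {fraction {poly R}} by rewrite tofrac_eq0 polyX_eq0.
pose x i := map_mx (coefp i) XP.
have Cx i : C *m x i = 0 by apply: poly_part_kernel XXP CX i.
(* [L] cuts out the column space of [E]. *)
pose L := (cokermx E^T)^T.
have LE : L *m E = 0 by apply: trmx_inj; rewrite trmx_mul trmxK mulmx_coker trmx0.
have LAx i : L *m A *m x i = 0.
  apply: poly_part_kernel XXP _ i.
  (* Multiplying by [L] removes both E X and E w, leaving L A X = 0. *)
  move: (congr1 (mulmx (const_to_rat L)) eqE).
  rewrite -constM mulmxA LE mul0mx const0 mulmxBr -scalemxAr !mulmxA -!constM.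
  by rewrite LE const0 mul0mx scaler0 sub0r => /eqP; rewrite oppr_eq0 => /eqP.
have Ax i : exists u, A *m x i = E *m u.
  have : ((A *m x i)^T <= E^T)%MS.
    by rewrite submxE -[cokermx _]trmxK -trmx_mul mulmxA LAx trmx0.
  case/submxP => D /(congr1 trmx); rewrite trmxK trmx_mul trmxK => ->.
  by exists D^T.
(* Comparing polynomial parts in [E X = (A X + E w) / s]. *)
have Ex i : E *m x i = A *m x i.+1.
  have EX : const_to_rat E *m X
      = (tofrac 'X)^-1 *: (const_to_rat A *m X + const_to_rat (E *m w)).
    by rewrite -eqE addrC subrK scalerA mulVf ?scale1r.
  have := is_poly_partVX (is_poly_partD (is_poly_part_mulmx A XXP)
            (is_poly_part_poly (map_mx polyC (E *m w)))).
  rewrite -EX => /(poly_part_unique (is_poly_part_mulmx E XXP)).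
  move/(congr1 (map_mx (coefp i))); rewrite map_coefp_mulmx => ->.
  (* Degree i after division by s comes from degree i + 1, where the constant E w contributes
     nothing. *)
  rewrite -map_coefp_mulmx; apply/matrixP => j k.
  by rewrite !mxE /= coef_drop_poly addn1 coefD coefC addr0.
(* Descending induction from the degree bound [N]: once x (i + 1) = 0, [Ex] gives E x i = 0 and [ND]
   applies. *)
have x0 i : x i = 0.
  pose N := \max_j size (XP j ord0).
  have big k : (N <= k)%N -> x k = 0.
    move=> Nk; apply/colP => j; rewrite !mxE /= nth_default //.
    by apply: leq_trans Nk; apply: leq_bigmax.
  case: (leqP N i) => [/big //|/ltnW iN].
  have : x (i + (N - i))%N = 0 by rewrite subnKC // big.
  move: (N - i)%N => d; elim: d i {iN} => [|d IHd] i; first by rewrite addn0.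
  rewrite addnS -addSn => /IHd xS.
  by apply: ND => //; rewrite Ex xS mulmx0.
apply/colP => j; apply/polyP => i.
by have /colP/(_ j) := x0 i; rewrite !mxE /= coef0.
Qed.

(** * Kernel and rank of O_k *)

(** The last block row has no A block; the convention v k = 0 lets it obey the same recurrence as
    the others. With p columns, a whole spanning set of ker E can be tested at once. *)
Lemma obs_mx_kernelP (R : realType) (m n p k : nat)
    (E A : 'M[R]_n) (C : 'M[R]_(m, n)) (v : nat -> 'M[R]_(n, p)) :
  v k = 0 ->
  obs_mx k E A C *m \mxcol_(j < k) v j = 0 <->
  (forall i, (i < k)%N -> E *m v i + A *m v i.+1 = 0) /\
  (forall i, (i < k.-1)%N -> C *m v i.+1 = 0).
Proof.
move=> vk; rewrite /obs_mx mul_col_mx !mul_mxblock_mxrow.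
have sumC (i : 'I_k.-1) :
    \sum_(j < k) (if j == i.+1 :> nat then C else 0) *m v j = C *m v i.+1.
  have ik : (i.+1 < k)%N by move: (ltn_ord i); rewrite ltn_predRL.
  rewrite (bigD1 (Ordinal ik)) //= eqxx big1 ?addr0 // => j.
  by rewrite -val_eqE /= => /negPf ->; rewrite mul0mx.
have sumE (i : 'I_k) :
    \sum_(j < k) (if j == i then E else if j == i.+1 :> nat then A else 0) *m v j
    = E *m v i + A *m v i.+1.
  rewrite (bigD1 i) //= eqxx; congr (_ + _).
  have [ik|ki] := ltnP i.+1 k.
    rewrite (bigD1 (Ordinal ik)) /=; last by rewrite -val_eqE /= gtn_eqF.
    rewrite -val_eqE /= gtn_eqF // eqxx big1 ?addr0 // => j.
    by rewrite -!val_eqE /= => /andP[/negPf -> /negPf ->]; rewrite mul0mx.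
  have -> : i.+1 = k by apply/eqP; rewrite eqn_leq ki ltn_ord.
  rewrite vk mulmx0 big1 // => j /negPf ->.
  by rewrite (ltn_eqF (ltn_ord j)) mul0mx.
rewrite (eq_mxcol sumE) (eq_mxcol sumC).
split=> [/eqP|[e c]].
  rewrite col_mx_eq0 => /andP[/eqP e /eqP c]; split=> i ik.
    by move/mxcolP/(_ (Ordinal ik)): e; rewrite mxcolK => ->; rewrite submxcol0.
  by move/mxcolP/(_ (Ordinal ik)): c; rewrite mxcolK => ->; rewrite submxcol0.
apply/eqP; rewrite col_mx_eq0; apply/andP; split; apply/eqP.
  by rewrite -[RHS]mxcol0; apply: eq_mxcol => i; apply: e.
by rewrite -[RHS]mxcol0; apply: eq_mxcol => i; apply: c.
Qed.

(** Transposing turns the left kernels given by [kermx] into the right kernels of M and E, of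
    dimensions q - rank M and n - rank E. Row freeness of P preserves the latter, so, given one
    inclusion, equal dimensions amount to the reverse one. Sums avoid truncated subtraction. *)
Lemma rank_kermx_tr_le (F : fieldType) (p q n' n : nat) (M : 'M[F]_(p, q))
    (E : 'M[F]_(n', n)) (P : 'M[F]_(n, q)) :
  row_free P -> (kermx E^T *m P <= kermx M^T)%MS ->
  (\rank M + n = q + \rank E)%N <-> (kermx M^T <= kermx E^T *m P)%MS.
Proof.
move=> Pfree sub; rewrite -(mxrank_leqif_sup sub) mxrankMfree // !mxrank_ker.
rewrite !mxrank_tr.
have En := rank_leq_col E; have Mq := rank_leq_col M.
by split=> [e|/eqP e]; [apply/eqP|]; lia.
Qed.

(** The right-hand side does not depend on r, which is what identifies the existential and universal
    rank conditions. *)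
Lemma rank_obs_mx (R : realType) (m n r : nat)
    (E A : 'M[R]_n) (C : 'M[R]_(m, n)) :
  \rank (obs_mx r.+2 E A C) = (n * r.+1 + \rank E)%N <->
  no_impulsive_direction E A C.
Proof.
set k := r.+2; set M := obs_mx _ _ _ _.
(* [P^T] embeds u as (u, 0, ..., 0). *)
pose P : 'M[R]_(n, \sum_(j < k) n) := \mxrow_(j < k) (j == ord0)%:R%:M.
have embE p (v : 'M[R]_(n, p)) :
    P^T *m v = \mxcol_(j < k) (if j == 0 :> nat then v else 0).
  rewrite tr_mxrow mxcol_mul; apply: eq_mxcol => j.
  rewrite tr_scalar_mx mul_scalar_mx -val_eqE /=.
  by case: (_ == _); rewrite ?scale1r ?scale0r.
have Pfree : row_free P.
  rewrite -kermx_eq0 -submx0; apply/rV_subP => y /sub_kermxP yP.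
  have /mxcolP/(_ ord0) : P^T *m y^T = 0 by rewrite -trmx_mul yP trmx0.
  rewrite embE mxcolK /= submxcol0 => /(congr1 trmx).
  by rewrite trmxK trmx0 => ->; apply: sub0mx.
have sub : (kermx E^T *m P <= kermx M^T)%MS.
  apply/sub_kermxP; apply: trmx_inj.
  rewrite trmx_mul trmxK trmx0 [(_ *m P)^T]trmx_mul embE.
  have EK : E *m (kermx E^T)^T = 0.
    by apply: trmx_inj; rewrite trmx_mul trmxK mulmx_ker trmx0.
  apply/(@obs_mx_kernelP _ _ _ _ _ E A C (fun j => if j == 0%N then _ else 0)) => //.
  split=> [[|i] _|i _] /=; first by rewrite EK mulmx0 addr0.
    by rewrite !mulmx0 addr0.
  by rewrite mulmx0.
(* O_k has n (r + 2) columns, so the n added on the left accounts for one block. *)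
have rankE : (\rank M = n * r.+1 + \rank E)%N <->
    (\rank M + n = \sum_(j < k) n + \rank E)%N.
  by move: (\rank M) => rM; rewrite sum_nat_const card_ord /k mulSn mulnC; lia.
rewrite rankE (rank_kermx_tr_le Pfree sub); split=> [le_ker v Ev Cv [w Aw]|ND].
  pose x i := if i is i'.+1 then if i' is _.+1 then 0 else v else - w.
  have Mx : M *m \mxcol_(j < k) x j = 0.
    apply/obs_mx_kernelP => //; split=> [[|[|i]] _|[|i] _] //=.
    - by rewrite mulmxN Aw addNr.
    - by rewrite Ev mulmx0 addr0.
    - by rewrite !mulmx0 addr0.
    - by rewrite mulmx0.
  have /submx_trans/(_ le_ker)/submxP[D] : ((\mxcol_(j < k) x j)^T <= kermx M^T)%MS.
    by apply/sub_kermxP; rewrite -trmx_mul Mx trmx0.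
  move/(congr1 trmx); rewrite trmxK mulmxA trmx_mul embE.
  (* Block 1 exists since k >= 2; it is v on one side and 0 on the other. *)
  by move/mxcolP/(_ (Ordinal (isT : (1 < k)%N))); rewrite !mxcolK.
apply/rV_subP => y /sub_kermxP yM.
(* The blocks of y are extended by zero, so that x k = 0 as the kernel criterion requires. *)
pose x i := if insub i is Some j then submxcol y^T j else 0 : 'cV[R]_n.
have xE (j : 'I_k) : x j = submxcol y^T j.
  by rewrite /x insubT // => jk; congr submxcol; apply: val_inj.
have yE : y^T = \mxcol_(j < k) x j.
  by rewrite -[LHS]submxcolK; apply: eq_mxcol => j; rewrite xE.
have xk i : (k <= i)%N -> x i = 0 by move=> ki; rewrite /x insubN // -leqNgt.
have : M *m \mxcol_(j < k) x j = 0 by rewrite -yE -[M]trmxK -trmx_mul yM trmx0.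
case/(obs_mx_kernelP _ _ _ (xk k (leqnn k))) => Ex Cx.
(* Descending induction on the blocks, ending at block 1. Block 0 escapes: no C row reaches it, and
   no row above puts A x 0 in im E. *)
have x0 i : x i.+1 = 0.
  case: (leqP k i.+1) => [/xk //|/ltnW ik].
  have : x (i.+1 + (k - i.+1))%N = 0 by rewrite subnKC // xk.
  move: (k - i.+1)%N => d; elim: d i ik => [|d IHd] i ik; first by rewrite addn0.
  rewrite addnS -addSn => xd.
  have [ki|ik'] := leqP k i.+1; first exact: xk.
  have xS := IHd _ ik' xd.
  apply: ND; [|by apply: Cx|].
    by have := Ex i.+1 ik'; rewrite xS mulmx0 addr0.
  (* Block row i reads A x (i + 1) = - E x i. *)
  exists (- x i); rewrite mulmxN; apply/eqP; rewrite -addr_eq0 addrC.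
  by rewrite Ex // ltnW.
(* Only block 0 of y is left, and block row 0 places it in ker E. *)
have -> : y = (x 0%N)^T *m P.
  apply: trmx_inj; rewrite trmx_mul trmxK embE yE; apply: eq_mxcol => -[[|j] jk] //=.
apply: submxMr; apply/sub_kermxP; rewrite -trmx_mul.
by have := Ex 0%N isT; rewrite x0 mulmx0 addr0 => ->; rewrite trmx0.
Qed.

Theorem theorem2p4 (R : realType) (m n : nat)
    (E A : 'M[R]_n) (C : 'M[R]_(m, n))
    (E_singular : E \notin unitmx) (EA_regular : regular_pencil E A) :
  [<-> impulse_observable E A C;
       exists r : 'I_n, \rank (obs_mx r.+2 E A C) = (n * r.+1 + \rank E)%N;
       forall r : 'I_n, \rank (obs_mx r.+2 E A C) = (n * r.+1 + \rank E)%N].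
Proof.
(* The empty matrix is a unit, so singularity forces n > 0; then r = 0 serves as witness for
   statement 2 and as instance of statement 3. *)
have n0 : (0 < n)%N.
  case: n E A C E_singular {EA_regular} => // E' _ _.
  by rewrite unitmxE det_mx00 unitr1.
tfae.
- by move/impulse_observableP => ND; exists (Ordinal n0); apply/rank_obs_mx.
- by case=> r /rank_obs_mx ND s; apply/rank_obs_mx.
- by move/(_ (Ordinal n0))/rank_obs_mx => ND; apply/impulse_observableP.
Qed.
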